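(* Let $V$ be an infinite-dimensional vector space over a field $\mathbb{F}$, let $w$ be a finite-rank endomorphism of $V$, let $\lambda\in\mathbb{F}$, and let $p_1,p_2,p_3\in\mathbb{F}[t]$ be split polynomials of degree $2$. Let $A\in[w]$, of size $n(w)\times n(w)$. Then the following are equivalent: (i) the endomorphism $\lambda\,\mathrm{id}_V+w$ is a $(p_1,p_2,p_3)$-sum; (ii) either $\lambda$ is a $(p_1,p_2,p_3)$-sum or $2\lambda=\operatorname{tr}p_1+\operatorname{tr}p_2+\operatorname{tr}p_3$, and there exists an integer $q\ge 0$ such that the block-diagonal matrix $(A+\lambda I_{n(w)})\oplus\lambda I_q$ is a $(p_1,p_2,p_3)$-sum.
   Context: An endomorphism (resp. square matrix) $u$ is a $(p_1,p_2,p_3)$-sum if $u=u_1+u_2+u_3$ for endomorphisms (resp. matrices of the same size) $u_k$ with $p_k(u_k)=0$ for all $k$. A scalar $\lambda$ is a $(p_1,p_2,p_3)$-sum if $\lambda=x_1+x_2+x_3$ with $x_k\in\mathbb{F}$ and $p_k(x_k)=0$. The trace $\operatorname{tr}p$ of a nonconstant polynomial $p$ with leading coefficient $\alpha$ is the opposite of the coefficient of $\alpha^{-1}p$ on $t^{\deg p-1}$. For a finite-rank endomorphism $w$ of $V$: choose a minimal (finite-dimensional) linear subspace $W$ of $V$ such that $\operatorname{im}w\subset W$ and $W+\operatorname{Ker}w=V$; its dimension $n(w)$ does not depend on the choice, and $[w]$ denotes the similarity class of matrices representing the endomorphism $w_{|W}$ of $W$, which also does not depend on the choice of $W$. *)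

(* Defs.v *)
From HB Require Import structures.
From mathcomp Require Import all_boot all_order all_algebra.
Set Implicit Arguments. Unset Strict Implicit. Unset Printing Implicit Defensive.
Import GRing.Theory.
Local Open Scope ring_scope.

Section Defs.
Variable F : fieldType.

Definition split_deg2 (p : {poly F}) : Prop :=
  size p = 3%N /\
  exists a b : F, p = lead_coef p *: (('X - a%:P) * ('X - b%:P)).

Definition poly_trace (p : {poly F}) : F :=
  - (p`_(size p - 2) / lead_coef p).

Definition scalar_sum3 (p1 p2 p3 : {poly F}) (lam : F) : Prop :=
  exists x1 x2 x3 : F,
    [/\ root p1 x1, root p2 x2, root p3 x3 & lam = x1 + x2 + x3].

Definition mx_poly_eval (n : nat) (p : {poly F}) (M : 'M[F]_n) : 'M[F]_n :=
  \sum_(i < size p) p`_i *: M ^+ i.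

Definition mx_sum3 (n : nat) (p1 p2 p3 : {poly F}) (M : 'M[F]_n) : Prop :=
  exists M1 M2 M3 : 'M[F]_n,
    [/\ mx_poly_eval p1 M1 = 0, mx_poly_eval p2 M2 = 0,
        mx_poly_eval p3 M3 = 0 & M = M1 + M2 + M3].

Variable V : lmodType F.

Definition end_poly_eval (p : {poly F}) (u : V -> V) (x : V) : V :=
  \sum_(i < size p) p`_i *: iter i u x.

Definition end_annihilated (p : {poly F}) (u : V -> V) : Prop :=
  forall x, end_poly_eval p u x = 0.

Definition end_sum3 (p1 p2 p3 : {poly F}) (f : V -> V) : Prop :=
  exists u1 u2 u3 : {linear V -> V},
    [/\ end_annihilated p1 u1, end_annihilated p2 u2, end_annihilated p3 u3
      & forall x, f x = u1 x + u2 x + u3 x].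

Definition in_span (n : nat) (e : 'I_n -> V) (x : V) : Prop :=
  exists c : 'I_n -> F, x = \sum_(i < n) c i *: e i.

Definition free_family (n : nat) (e : 'I_n -> V) : Prop :=
  forall c : 'I_n -> F, \sum_(i < n) c i *: e i = 0 -> forall i, c i = 0.

Definition infinite_dim : Prop :=
  forall (n : nat) (e : 'I_n -> V), exists x, ~ in_span e x.

Definition finite_rank (w : V -> V) : Prop :=
  exists (n : nat) (e : 'I_n -> V), forall x, in_span e (w x).

Definition is_subspace (P : V -> Prop) : Prop :=
  P 0 /\ forall (a : F) x y, P x -> P y -> P (a *: x + y).

Definition adapted_subspace (w : V -> V) (P : V -> Prop) : Prop :=
  is_subspace P /\ (forall x, P (w x)) /\
  (forall x, exists y, P y /\ w (x - y) = 0).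

Definition minimal_adapted_basis (w : V -> V) (n : nat) (e : 'I_n -> V) : Prop :=
  free_family e /\ adapted_subspace w (in_span e) /\
  forall P : V -> Prop, adapted_subspace w P ->
    (forall x, P x -> in_span e x) -> forall x, in_span e x -> P x.

Definition matrix_in_basis (w : V -> V) (n : nat) (e : 'I_n -> V) (A : 'M[F]_n) : Prop :=
  forall j : 'I_n, w (e j) = \sum_(i < n) A i j *: e i.

(* A ∈ [w]: A represents w_|W for some minimal admissible W (n = n(w)) *)
Definition in_class (w : V -> V) (n : nat) (A : 'M[F]_n) : Prop :=
  exists e : 'I_n -> V, minimal_adapted_basis w e /\ matrix_in_basis w e A.

End Defs.

(* Main.v *)
(* (i) => (ii).  Since [u3 = lam + w - u1 - u2] is quadratic, [u1 u2 + u2 u1] is, up to terms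
   factoring through [w], a combination of [1], [u1] and [u2].  Hence
   [E = W + u1 W + u2 W + u1 u2 W] is finite-dimensional and stable under all [u_k]; completing
   a basis of [W] to one of [E] by vectors of [Ker w] gives the block matrix.  Modulo [E] the
   same relation yields [(tr p1 + tr p2 + tr p3 - 2 lam) (u1 u2 - u2 u1) = 0], so either the
   trace condition holds or [u1] and [u2] commute modulo [E] and have a common eigenvector
   there, which exhibits [lam] as a sum of roots.
   (ii) => (i).  Either alternative makes [lam I_2] a sum.  Starting from the given block matrix,
   Zorn's lemma extends the solution by planes inside [Ker w], keeping an infinite independent
   sequence aside; at most one more vector is then missing, and it is absorbed, Hilbert-hotel
   style, by pairing it up with the reserved sequence. *)
Require Import Defs.
From HB Require Import structures.
From mathcomp Require Import all_boot all_order all_algebra.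
From mathcomp Require Import boolp classical_sets ring.
Set Implicit Arguments. Unset Strict Implicit. Unset Printing Implicit Defensive.
Import GRing.Theory.
Local Open Scope ring_scope.

(** * Reflexive procedure for identities between linear combinations *)

Inductive lexp (F : Type) : Type :=
  | LVar of nat | LZero | LAdd of lexp F & lexp F | LOpp of lexp F
  | LScale of F & lexp F.
Arguments LVar {F}.
Arguments LZero {F}.

Fixpoint lexp_eval (F : fieldType) (V : lmodType F) (s : seq V) (e : lexp F) : V :=
  match e with
  | LVar i => nth 0 s i
  | LZero => 0
  | LAdd e1 e2 => lexp_eval s e1 + lexp_eval s e2
  | LOpp e1 => - lexp_eval s e1
  | LScale a e1 => a *: lexp_eval s e1
  end.

Fixpoint lexp_coef (F : fieldType) (e : lexp F) (j : nat) : F :=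
  match e with
  | LVar i => if i == j then 1 else 0
  | LZero => 0
  | LAdd e1 e2 => lexp_coef e1 j + lexp_coef e2 j
  | LOpp e1 => - lexp_coef e1 j
  | LScale a e1 => a * lexp_coef e1 j
  end.

(** A recursive conjunction, so that simplification and [repeat split] leave one ring identity per
    atom. *)
Fixpoint lexp_agree (F : fieldType) (e1 e2 : lexp F) (k : nat) : Prop :=
  if k is k'.+1 then lexp_coef e1 k' = lexp_coef e2 k' /\ lexp_agree e1 e2 k'
  else True.

Lemma lexp_evalE (F : fieldType) (V : lmodType F) (s : seq V) (e : lexp F) :
  lexp_eval s e = \sum_(j < size s) lexp_coef e j *: s`_j.
Proof.
elim: e => [i||e1 IH1 e2 IH2|e1 IH1|a e1 IH1] /=.
- case: (ltnP i (size s)) => [lt_is|le_si].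
    rewrite (bigD1 (Ordinal lt_is)) //= eqxx scale1r big1 ?addr0 // => j neq_ji.
    by rewrite ifN ?scale0r // eq_sym; apply: contraNN neq_ji => /eqP eq_ij; apply/eqP/val_inj.
  rewrite nth_default // big1 // => j _; rewrite ifN ?scale0r //.
  by rewrite neq_ltn (leq_trans (ltn_ord j) le_si) orbT.
- by rewrite big1 // => j _; rewrite scale0r.
- by rewrite IH1 IH2 -big_split; apply: eq_bigr => j _; rewrite scalerDl.
- by rewrite IH1 -sumrN; apply: eq_bigr => j _; rewrite scaleNr.
- by rewrite IH1 scaler_sumr; apply: eq_bigr => j _; rewrite scalerA.
Qed.

Lemma lexp_eval_eq (F : fieldType) (V : lmodType F) (s : seq V) (e1 e2 : lexp F) :
  lexp_agree e1 e2 (size s) -> lexp_eval s e1 = lexp_eval s e2.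
Proof.
rewrite !lexp_evalE; elim: (size s) => [|k IHk] /=; first by rewrite !big_ord0.
by case=> eq_k /IHk eq_s; rewrite !big_ord_recr /= eq_s eq_k.
Qed.

Ltac lexp_mem x s :=
  lazymatch s with
  | nil => constr:(false)
  | cons x _ => constr:(true)
  | cons _ ?s' => lexp_mem x s'
  end.
Ltac lexp_index x s :=
  lazymatch s with
  | cons x _ => constr:(0%N)
  | cons _ ?s' => let i := lexp_index x s' in constr:(S i)
  end.
Ltac lexp_atoms t s :=
  lazymatch t with
  | (?x + ?y)%R => let s1 := lexp_atoms x s in lexp_atoms y s1
  | (- ?x)%R => lexp_atoms x s
  | (_ *: ?x)%R => lexp_atoms x s
  | 0%R => s
  | ?x => lazymatch lexp_mem x s with true => s | false => constr:(cons x s) end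
  end.
Ltac lexp_reify F t s :=
  lazymatch t with
  | (?x + ?y)%R => let a := lexp_reify F x s in let b := lexp_reify F y s in
                   constr:(@LAdd F a b)
  | (- ?x)%R => let a := lexp_reify F x s in constr:(@LOpp F a)
  | (?c *: ?x)%R => let a := lexp_reify F x s in constr:(@LScale F c a)
  | 0%R => constr:(@LZero F)
  | ?x => let i := lexp_index x s in constr:(@LVar F i)
  end.

(* Proves an equality between linear combinations, coefficient by coefficient. *)
Ltac module_eq F :=
  lazymatch goal with
  | |- @eq ?V ?x ?y =>
    let s := lexp_atoms x (@nil V) in let s := lexp_atoms y s in
    let e1 := lexp_reify F x s in let e2 := lexp_reify F y s in
    apply: (@lexp_eval_eq F _ s e1 e2); rewrite /=; repeat split; ring
  end.

(** * Split quadratics and decompositions of [lam I_2] *)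

(** The last clause takes an arbitrary sequence [y], so that it covers both powers of a matrix and
    iterates of an endomorphism at a vector. *)
Lemma split_deg2P (F : fieldType) (p : {poly F}) : split_deg2 p ->
  exists a b : F, [/\ poly_trace p = a + b,
    forall x, root p x = (x == a) || (x == b)
    & forall (U : lmodType F) (y : nat -> U),
        \sum_(i < size p) p`_i *: y i = 0 <->
        y 2%N = (a + b) *: y 1%N - (a * b) *: y 0%N].
Proof.
case=> size_p [a [b p_eq]]; exists a, b.
have lead_neq0 : lead_coef p != 0.
  by rewrite lead_coef_eq0 -size_poly_eq0 size_p.
have q_eq : ('X - a%:P) * ('X - b%:P) = 'X^2 - (a + b) *: 'X + (a * b)%:P.
  by rewrite -mul_polyC polyCD polyCM; ring.
have p0 : p`_0 = lead_coef p * (a * b).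
  by rewrite {1}p_eq q_eq !coefE /=; ring.
have p1 : p`_1 = - (lead_coef p * (a + b)).
  by rewrite {1}p_eq q_eq !coefE /=; ring.
have p2 : p`_2 = lead_coef p by rewrite lead_coefE size_p.
split.
- by rewrite /poly_trace size_p p1 mulNr opprK mulrC mulrA mulVf ?mul1r.
- move=> x; rewrite {1}p_eq rootE hornerZ hornerM !hornerXsubC !mulf_eq0.
  by rewrite (negPf lead_neq0) !subr_eq0.
- move=> U y; rewrite size_p !big_ord_recr big_ord0 /= add0r p0 p1 p2.
  transitivity (lead_coef p *: (y 2%N - ((a + b) *: y 1%N - (a * b) *: y 0%N)) = 0).
    by split=> <-; module_eq F.
  split=> [/eqP|->]; last by rewrite subrr scaler0.
  by rewrite scaler_eq0 (negPf lead_neq0) subr_eq0 => /eqP.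
Qed.

Lemma ord2_cases (k : 'I_2) : k = 0 \/ k = 1.
Proof. by case: k => -[|[|k]] // lt_k; [left|right]; apply: val_inj. Qed.

(** Take [N1] upper and [N2] lower triangular with the prescribed eigenvalues. The hypothesis gives
    [lam I_2 - N1 - N2] the trace [a3 + b3], and the free corner of [N2] adjusts its determinant;
    Cayley-Hamilton then yields all three relations. *)
Lemma scalar_block_sum (F : fieldType) (lam a1 b1 a2 b2 a3 b3 : F) :
  2%:R * lam = (a1 + b1) + (a2 + b2) + (a3 + b3) ->
  exists N1 N2 N3 : 'M[F]_2,
    [/\ N1 *m N1 = (a1 + b1) *: N1 - (a1 * b1)%:M,
        N2 *m N2 = (a2 + b2) *: N2 - (a2 * b2)%:M,
        N3 *m N3 = (a3 + b3) *: N3 - (a3 * b3)%:M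
      & lam%:M = N1 + N2 + N3].
Proof.
move=> eq_lam.
pose mx (x y z t : F) : 'M[F]_2 :=
  \matrix_(i, j) if i == 0 then (if j == 0 then x else y)
                 else if j == 0 then z else t.
have mx_eq (M N : 'M[F]_2) : M 0 0 = N 0 0 -> M 0 1 = N 0 1 -> M 1 0 = N 1 0 ->
    M 1 1 = N 1 1 -> M = N.
  move=> e00 e01 e10 e11; apply/matrixP => i j.
  by case: (ord2_cases i) => ->; case: (ord2_cases j) => ->.
(* The third matrix has trace [a3 + b3]; [z] is chosen to give it determinant [a3 * b3]. *)
pose z := (lam - b1 - a2) * (lam - a1 - b2) - a3 * b3.
(* Solving for [b3] rather than [lam] avoids dividing by 2, so every characteristic is covered. *)
have b3E : b3 = 2%:R * lam - a1 - b1 - a2 - b2 - a3 by rewrite eq_lam; ring.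
exists (mx b1 1 0 a1), (mx a2 0 z b2), (mx (lam - b1 - a2) (-1) (- z) (lam - a1 - b2)).
split; apply: mx_eq; rewrite !mxE ?big_ord_recl ?big_ord0 ?mxE /= ?mulr1n ?mulr0n;
  rewrite /z ?b3E; ring.
Qed.

(** * Subspaces, adjunction of vectors, and coordinates *)

Section Subspaces.
Variables (F : fieldType) (V : lmodType F).
Implicit Types (P D : V -> Prop) (z : nat -> V).

Lemma subspace0 P : is_subspace P -> P 0.
Proof. by case. Qed.

Lemma subspaceZ P a x : is_subspace P -> P x -> P (a *: x).
Proof. by case=> P0 PD Px; have := PD a x 0 Px P0; rewrite addr0. Qed.

Lemma subspaceD P x y : is_subspace P -> P x -> P y -> P (x + y).
Proof. by case=> P0 PD Px Py; have := PD 1 x y Px Py; rewrite scale1r. Qed.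

Lemma subspaceN P x : is_subspace P -> P x -> P (- x).
Proof. by move=> sP Px; rewrite -scaleN1r; apply: subspaceZ. Qed.

Lemma subspaceB P x y : is_subspace P -> P x -> P y -> P (x - y).
Proof. by move=> sP Px Py; apply: subspaceD => //; apply: subspaceN. Qed.

Lemma subspace_sum P (I : finType) (f : I -> V) :
  is_subspace P -> (forall i, P (f i)) -> P (\sum_i f i).
Proof.
move=> sP Pf; apply: big_ind => // [|x y]; first exact: subspace0.
exact: subspaceD.
Qed.

Lemma subspace_preim P (u : {linear V -> V}) :
  is_subspace P -> is_subspace (fun x => P (u x)).
Proof.
case=> P0 PD; split; first by rewrite linear0.
by move=> a x y Px Py; rewrite linearP; apply: PD.
Qed.

Definition add_line P (x : V) : V -> Prop := fun v => exists a : F, P (v - a *: x).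

(** Independence of [z] modulo [P] is expressed throughout as [~ add_seq P z i (z i)]: no term lies
    in [P] plus the span of the earlier ones. *)
Fixpoint add_seq P (z : nat -> V) (n : nat) : V -> Prop :=
  if n is n'.+1 then add_line (add_seq P z n') (z n') else P.

Lemma add_line_subspace P x : is_subspace P -> is_subspace (add_line P x).
Proof.
move=> sP; split; first by exists 0; rewrite scale0r subrr; apply: subspace0.
move=> a v v' [b Pv] [b' Pv']; exists (a * b + b').
rewrite (_ : _ - _ = a *: (v - b *: x) + (v' - b' *: x)); last by module_eq F.
by case: sP => _; apply.
Qed.

Lemma sub_add_line P x v : P v -> add_line P x v.
Proof. by move=> Pv; exists 0; rewrite scale0r subr0. Qed.

Lemma add_line_mem P x : is_subspace P -> add_line P x x.
Proof. by move=> sP; exists 1; rewrite scale1r subrr; apply: subspace0. Qed.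

Lemma add_line_min P Q x : is_subspace Q -> (forall v, P v -> Q v) -> Q x ->
  forall v, add_line P x v -> Q v.
Proof.
move=> sQ PQ Qx v [a /PQ Qv]; rewrite -(subrK (a *: x) v).
by apply: subspaceD => //; apply: subspaceZ.
Qed.

Lemma add_line_mono P Q x v :
  (forall v, P v -> Q v) -> add_line P x v -> add_line Q x v.
Proof. by move=> PQ [a /PQ]; exists a. Qed.

Lemma add_lineC P x y v : add_line (add_line P x) y v -> add_line (add_line P y) x v.
Proof. by move=> [a [b Pv]]; exists b, a; rewrite addrAC. Qed.

(** Steinitz exchange: in a relation [y = p + a *: x] the scalar [a] is nonzero because [y] is
    outside [P], so [x] would lie in [Q]. *)
Lemma add_line_notin P Q x y : is_subspace P -> is_subspace Q ->
  (forall v, P v -> Q v) -> Q y -> ~ P y -> ~ Q x -> ~ add_line P x y.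
Proof.
move=> sP sQ PQ Qy notPy notQx [a Pa]; have [a0|a_neq0] := eqVneq a 0.
  by apply: notPy; move: Pa; rewrite a0 scale0r subr0.
apply: notQx; rewrite -[x]scale1r -(mulVf a_neq0) -scalerA.
apply: subspaceZ => //; rewrite (_ : a *: x = y - (y - a *: x)); last by module_eq F.
by apply: subspaceB => //; apply: PQ.
Qed.

Lemma add_seq_subspace P z n : is_subspace P -> is_subspace (add_seq P z n).
Proof. by move=> sP; elim: n => //= n IHn; apply: add_line_subspace. Qed.

Lemma add_seq_le P z m n v : (m <= n)%N -> add_seq P z m v -> add_seq P z n v.
Proof.
elim: n => [|n IHn]; first by rewrite leqn0 => /eqP ->.
rewrite leq_eqVlt => /orP[/eqP-> //|le_mn] Pv; apply: sub_add_line; exact: IHn.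
Qed.

Lemma add_seq_mono P Q z n v :
  (forall v, P v -> Q v) -> add_seq P z n v -> add_seq Q z n v.
Proof. by move=> PQ; elim: n v => [|n IHn] v /=; [apply: PQ|apply: add_line_mono]. Qed.

Lemma eq_add_seq P z z' n : (forall i, (i < n)%N -> z i = z' i) ->
  add_seq P z n = add_seq P z' n.
Proof.
elim: n => //= n IHn eq_z; rewrite eq_z // IHn // => i lt_in; apply: eq_z; exact: leqW.
Qed.

Lemma add_seq_add P z m n :
  add_seq (add_seq P z m) (fun i => z (m + i)%N) n = add_seq P z (m + n).
Proof. by elim: n => [|n IHn] /=; rewrite ?addn0 // addnS /= IHn. Qed.

Lemma add_seq_line P x z n v :
  add_seq (add_line P x) z n v <-> add_line (add_seq P z n) x v.
Proof.
elim: n v => //= n IHn v; split.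
  by move=> Pv; apply: add_lineC; apply: add_line_mono Pv => u /IHn.
by move=> /add_lineC Pv; apply: add_line_mono Pv => u /IHn.
Qed.

(** Coordinates form a column, so that endomorphisms act on them by left multiplication with a
    matrix. *)
Definition comb (m : nat) (f : 'I_m -> V) (c : 'cV[F]_m) : V := \sum_i c i 0 *: f i.

Lemma comb_is_linear m (f : 'I_m -> V) : linear (comb f).
Proof.
move=> a c d; rewrite /comb scaler_sumr -big_split; apply: eq_bigr => i _.
by rewrite !mxE scalerDl scalerA.
Qed.
HB.instance Definition _ m (f : 'I_m -> V) :=
  GRing.isLinear.Build F 'cV[F]_m V _ (comb f) (comb_is_linear f).

Lemma in_spanP m (f : 'I_m -> V) x : in_span f x <-> exists c, x = comb f c.
Proof.
split=> [[c ->]|[c ->]]; last by exists (fun i => c i 0).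
by exists (\col_i c i); apply: eq_bigr => i _; rewrite mxE.
Qed.

Lemma in_span_subspace m (f : 'I_m -> V) : is_subspace (in_span f).
Proof.
split; first by apply/in_spanP; exists 0; rewrite linear0.
move=> a x y /in_spanP[c ->] /in_spanP[d ->]; apply/in_spanP.
by exists (a *: c + d); rewrite linearP.
Qed.

Lemma comb_delta m (f : 'I_m -> V) i : comb f (delta_mx i 0) = f i.
Proof.
rewrite /comb (bigD1 i) //= mxE !eqxx scale1r big1 ?addr0 // => j /negPf neq_ji.
by rewrite mxE neq_ji scale0r.
Qed.

Lemma in_span_mem m (f : 'I_m -> V) i : in_span f (f i).
Proof. by apply/in_spanP; exists (delta_mx i 0); rewrite comb_delta. Qed.

Lemma comb_mulmx m (f : 'I_m -> V) (u : {linear V -> V}) (M : 'M[F]_m) c :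
  (forall j, u (f j) = \sum_i M i j *: f i) -> u (comb f c) = comb f (M *m c).
Proof.
move=> uf; rewrite /comb linear_sum.
under eq_bigr do rewrite linearZ /= uf scaler_sumr.
rewrite exchange_big; apply: eq_bigr => i _ /=.
by rewrite mxE scaler_suml; apply: eq_bigr => j _; rewrite scalerA mulrC.
Qed.

Definition fcat (m k : nat) (f : 'I_m -> V) (g : 'I_k -> V) (i : 'I_(m + k)) : V :=
  match split i with inl j => f j | inr j => g j end.

Lemma comb_fcat m k (f : 'I_m -> V) (g : 'I_k -> V) c d :
  comb (fcat f g) (col_mx c d) = comb f c + comb g d.
Proof.
rewrite /comb big_split_ord; congr (_ + _); apply: eq_bigr => i _.
  by rewrite col_mxEu /fcat (unsplitK (inl _ i)).
by rewrite col_mxEd /fcat (unsplitK (inr _ i)).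
Qed.

Definition trunc (z : nat -> V) (q : nat) : 'I_q -> V := fun i => z i.
Arguments trunc z q : clear implicits.

Lemma comb_trunc0 z c : comb (trunc z 0) c = 0.
Proof. exact: big_ord0. Qed.

Lemma comb_truncS z q (c : 'cV[F]_(q.+1)) :
  comb (trunc z q.+1) c =
  comb (trunc z q) (\col_i c (widen_ord (leqnSn q) i) 0) + c ord_max 0 *: z q.
Proof.
by rewrite /comb big_ord_recr /=; congr (_ + _); apply: eq_bigr => i _; rewrite mxE.
Qed.

Lemma comb_trunc_in P z q c : is_subspace P -> add_seq P z q (comb (trunc z q) c).
Proof.
move=> sP; elim: q c => [|q IHq] c; first by rewrite comb_trunc0; apply: subspace0.
rewrite comb_truncS /=; exists (c ord_max 0); rewrite addrK; exact: IHq.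
Qed.

(** Bridge between finite families, which carry matrices, and iterated adjunction, which suits
    inductive constructions. *)
Lemma in_span_fcat m (f : 'I_m -> V) z q v :
  in_span (fcat f (trunc z q)) v <-> add_seq (in_span f) z q v.
Proof.
have sf := in_span_subspace f; split.
  move=> /in_spanP[c ->]; rewrite -(vsubmxK c) comb_fcat; apply: subspaceD.
  - exact: add_seq_subspace.
  - by apply: (@add_seq_le _ _ 0) => //; apply/in_spanP; exists (usubmx c).
  - exact: comb_trunc_in.
suff comb_ex : add_seq (in_span f) z q v ->
    exists c d, v = comb f c + comb (trunc z q) d.
  by move=> /comb_ex[c [d ->]]; apply/in_spanP; exists (col_mx c d); rewrite comb_fcat.
elim: q v => [|q IHq] v /=.
  by move=> /in_spanP[c ->]; exists c, 0; rewrite linear0 addr0.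
move=> [a /IHq[c [d v_eq]]]; exists c.
(* [insub] fails exactly at the last index, which receives the new coefficient [a]. *)
exists (\col_i if insub (val i) is Some j then d j 0 else a).
rewrite comb_truncS mxE insubF ?ltnn //= addrA -[LHS](subrK (a *: z q)) v_eq.
congr (_ + comb _ _ + _); apply/matrixP => i j; rewrite !mxE /= insubT //= => lt_iq.
by rewrite ord1; congr (d _ _); apply: val_inj.
Qed.

(** By induction on [q]: a nonzero last coefficient would put the last [z] in the span of what
    precedes it. *)
Lemma fcat_free m (f : 'I_m -> V) z q :
  (forall c, comb f c = 0 -> c = 0) ->
  (forall i, (i < q)%N -> ~ add_seq (in_span f) z i (z i)) ->
  forall c, comb (fcat f (trunc z q)) c = 0 -> c = 0.
Proof.
move=> free_f free_z c; rewrite -(vsubmxK c) comb_fcat.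
move: (usubmx c) (dsubmx c) => {}c d.
suff cd0 : comb f c + comb (trunc z q) d = 0 -> c = 0 /\ d = 0.
  by move=> /cd0[-> ->]; rewrite col_mx0.
have sf := in_span_subspace f.
elim: q free_z d => [|q IHq] free_z d.
  by rewrite comb_trunc0 addr0 => /free_f->; split=> //; apply/matrixP => -[].
rewrite comb_truncS addrA; set d' := \col_i _; set a := d _ _ => eq0.
have a0 : a = 0.
  apply/eqP/negPn/negP => a_neq0; apply: (free_z q) => //.
  rewrite -[z q]scale1r -(mulVf a_neq0) -scalerA.
  have sq := add_seq_subspace z q sf.
  apply: subspaceZ => //; rewrite -[a *: _]opprK.
  move/eqP: eq0; rewrite addrC addr_eq0 => /eqP->; rewrite opprK.
  apply: subspaceN => //; apply: subspaceD => //; last exact: comb_trunc_in.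
  by apply: (@add_seq_le _ _ 0) => //; apply/in_spanP; exists c.
move: eq0; rewrite a0 scale0r addr0 => /IHq[]; first by move=> i lt_iq; apply: free_z; apply: leqW.
move=> -> d'0; split=> //; apply/matrixP => i j; rewrite ord1 mxE.
case: (unliftP ord_max i) => [k ->|->] //.
have := congr1 (fun M : 'cV_q => M k 0) d'0; rewrite !mxE => <-.
by congr (d _ _); apply: val_inj; rewrite /= /bump leqNgt ltn_ord.
Qed.

End Subspaces.
Arguments trunc {F V} z q i.

(** * Partial solutions and their extension to the whole space *)

Section PartialSolutions.
Local Open Scope classical_set_scope.
Local Open Scope ring_scope.
Variables (F : fieldType) (V : lmodType F) (w : {linear V -> V}).
Variables (lam s1 t1 s2 t2 s3 t3 : F).
Implicit Types (G H : set (V * V * V)) (x y v : V) (z : nat -> V).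

(** The value forced on [u3 x] once [u1 x = a] and [u2 x = b]. *)
Definition third (x a b : V) : V := lam *: x + w x - a - b.

(* [G] is the joint graph [(x, u1 x, u2 x)] of [u1] and [u2] on a subspace that is
   stable under [u1], [u2] and [u3 = lam + w - u1 - u2]. *)
Record partial_sol G : Prop := PartialSol {
  psol_sub : is_subspace G;
  psol_fun : forall a b, G (0, a, b) -> a = 0 /\ b = 0;
  psol_1 : forall x a b, G (x, a, b) -> exists c, G (a, s1 *: a - t1 *: x, c);
  psol_2 : forall x a b, G (x, a, b) -> exists c, G (b, c, s2 *: b - t2 *: x);
  psol_3 : forall x a b, G (x, a, b) -> exists c d, G (third x a b, c, d) /\
    third (third x a b) c d = s3 *: third x a b - t3 *: x }.

Definition dom G (x : V) : Prop := exists a b, G (x, a, b).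

Lemma third_linear k x a b x' a' b' :
  third (k *: x + x') (k *: a + a') (k *: b + b') = k *: third x a b + third x' a' b'.
Proof. rewrite /third linearP; module_eq F. Qed.

Lemma thirdD x a b x' a' b' :
  third (x + x') (a + a') (b + b') = third x a b + third x' a' b'.
Proof. by have := third_linear 1 x a b x' a' b'; rewrite !scale1r. Qed.

Lemma graph_lin G k x a b x' a' b' : is_subspace G ->
  G (x, a, b) -> G (x', a', b') -> G (k *: x + x', k *: a + a', k *: b + b').
Proof. by move=> [_ GP] Gx Gx'; apply: (GP k (x, a, b) (x', a', b')). Qed.

Lemma dom_subspace G : is_subspace G -> is_subspace (dom G).
Proof.
move=> sG; split; first by exists 0, 0; case: sG.
move=> k x y [a [b Gx]] [a' [b' Gy]].
by exists (k *: a + a'), (k *: b + b'); apply: graph_lin.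
Qed.

Lemma psol_uniq G x a b a' b' : partial_sol G ->
  G (x, a, b) -> G (x, a', b') -> a = a' /\ b = b'.
Proof.
move=> sG Gx Gx'; have := graph_lin (-1) (psol_sub sG) Gx' Gx.
rewrite !scaleN1r addNr => G0; have [/eqP + /eqP] := psol_fun sG G0.
by rewrite ![- _ + _]addrC !subr_eq0 => /eqP-> /eqP->.
Qed.

Definition addset G H : set (V * V * V) :=
  fun g => exists g1 g2, [/\ G g1, H g2 & g = g1 + g2].

Lemma addsetP G H x a b : addset G H (x, a, b) <->
  exists x1 a1 b1 x2 a2 b2, [/\ G (x1, a1, b1), H (x2, a2, b2)
    & [/\ x = x1 + x2, a = a1 + a2 & b = b1 + b2]].
Proof.
split.
  move=> [[[x1 a1] b1] [[[x2 a2] b2] [Gg Hg eq_g]]].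
  by exists x1, a1, b1, x2, a2, b2; split => //; case: eq_g.
move=> [x1 [a1 [b1 [x2 [a2 [b2 [Gg Hg [-> -> ->]]]]]]]].
by exists (x1, a1, b1), (x2, a2, b2).
Qed.

(** Direct sum of two solutions. Trivial intersection of the domains is what keeps the sum
    single-valued. *)
Lemma partial_sol_add G H : partial_sol G -> partial_sol H ->
  (forall x, dom G x -> dom H x -> x = 0) -> partial_sol (addset G H).
Proof.
move=> sG sH GH0; split.
- split.
    exists 0, 0; split; [exact: subspace0 (psol_sub sG)|exact: subspace0 (psol_sub sH)|].
    by rewrite addr0.
  move=> k _ _ [g1 [h1 [Gg1 Hh1 ->]]] [g2 [h2 [Gg2 Hh2 ->]]].
  exists (k *: g1 + g2), (k *: h1 + h2); split.
  + by case: (psol_sub sG) => _; apply.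
  + by case: (psol_sub sH) => _; apply.
  + by rewrite scalerDr addrACA.
- move=> a b /addsetP[x1 [a1 [b1 [x2 [a2 [b2 [Gg Hg [/esym/eqP + -> ->]]]]]]]].
  rewrite addr_eq0 => /eqP x1E.
  have x20 : x2 = 0.
    apply: GH0; last by exists a2, b2.
    rewrite -[x2]opprK -x1E; apply: subspaceN; last by exists a1, b1.
    exact: dom_subspace (psol_sub sG).
  move: Gg Hg; rewrite x1E x20 oppr0 => G0 H0.
  have [-> ->] := psol_fun sG G0; have [-> ->] := psol_fun sH H0.
  by rewrite addr0.
- move=> x a b /addsetP[x1 [a1 [b1 [x2 [a2 [b2 [Gg Hg [-> -> _]]]]]]]].
  have [c Gc] := psol_1 sG Gg; have [d Hd] := psol_1 sH Hg.
  exists (c + d); apply/addsetP; exists a1, (s1 *: a1 - t1 *: x1), c.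
  by exists a2, (s1 *: a2 - t1 *: x2), d; split=> //; split=> //; module_eq F.
- move=> x a b /addsetP[x1 [a1 [b1 [x2 [a2 [b2 [Gg Hg [-> _ ->]]]]]]]].
  have [c Gc] := psol_2 sG Gg; have [d Hd] := psol_2 sH Hg.
  exists (c + d); apply/addsetP; exists b1, c, (s2 *: b1 - t2 *: x1).
  by exists b2, d, (s2 *: b2 - t2 *: x2); split=> //; split=> //; module_eq F.
- move=> x a b /addsetP[x1 [a1 [b1 [x2 [a2 [b2 [Gg Hg [-> -> ->]]]]]]]].
  have [c [d [Gc cdE]]] := psol_3 sG Gg; have [c' [d' [Hc cdE']]] := psol_3 sH Hg.
  exists (c + c'), (d + d'); rewrite !thirdD cdE cdE'; split; last by module_eq F.
  by apply/addsetP; exists (third x1 a1 b1), c, d, (third x2 a2 b2), c', d'; split.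
Qed.

(** Closure under linear combinations involves two points, both lying in the larger of two members
    of the chain; each other clause starts from a single point. *)
Lemma partial_sol_bigcup (C : set (set (V * V * V))) :
  (exists G, C G) -> total_on C subset -> (forall G, C G -> partial_sol G) ->
  partial_sol (fun g => exists2 G, C G & G g).
Proof.
move=> [G0 CG0] totC solC; split.
- split; first by exists G0 => //; case: (psol_sub (solC _ CG0)).
  move=> k g h [G CG Gg] [H CH Hh].
  have [GH|HG] := totC G H CG CH.
    by exists H => //; case: (psol_sub (solC _ CH)) => _; apply=> //; apply: GH.
  by exists G => //; case: (psol_sub (solC _ CG)) => _; apply=> //; apply: HG.
- by move=> a b [G CG]; exact: (psol_fun (solC _ CG)).
- by move=> x a b [G CG /(psol_1 (solC _ CG))[c Gc]]; exists c, G.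
- by move=> x a b [G CG /(psol_2 (solC _ CG))[c Gc]]; exists c, G.
- move=> x a b [G CG /(psol_3 (solC _ CG))[c [d [Gc cdE]]]]; exists c, d.
  by split=> //; exists G.
Qed.

(** Choice extracts [u1] and [u2] from the graph, and uniqueness of values makes them linear; [u3]
    is [third]. *)
Lemma partial_sol_total G : partial_sol G -> (forall x, dom G x) ->
  exists u1 u2 u3 : {linear V -> V},
    [/\ forall x, u1 (u1 x) = s1 *: u1 x - t1 *: x,
        forall x, u2 (u2 x) = s2 *: u2 x - t2 *: x,
        forall x, u3 (u3 x) = s3 *: u3 x - t3 *: x
      & forall x, lam *: x + w x = u1 x + u2 x + u3 x].
Proof.
move=> sG domG.
have [f1 f1P] := choice domG; have [f2 f2P] := choice f1P.
have f_eq x a b : G (x, a, b) -> f1 x = a /\ f2 x = b by apply: psol_uniq.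
have f_lin k x y : f1 (k *: x + y) = k *: f1 x + f1 y /\ f2 (k *: x + y) = k *: f2 x + f2 y.
  by apply: f_eq; apply: graph_lin => //; apply: psol_sub.
have f1_lin : linear f1 by move=> k x y; case: (f_lin k x y).
have f2_lin : linear f2 by move=> k x y; case: (f_lin k x y).
have f3_lin : linear (fun x => third x (f1 x) (f2 x)).
  by move=> k x y; rewrite f1_lin f2_lin third_linear.
pose l1 := GRing.isLinear.Build F V V _ f1 f1_lin.
pose l2 := GRing.isLinear.Build F V V _ f2 f2_lin.
pose l3 := GRing.isLinear.Build F V V _ _ f3_lin.
pose u1 : {linear V -> V} := HB.pack f1 l1.
pose u2 : {linear V -> V} := HB.pack f2 l2.
pose u3 : {linear V -> V} := HB.pack (fun x => third x (f1 x) (f2 x)) l3.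
exists u1, u2, u3; split=> x /=.
- by have [c /f_eq[]] := psol_1 sG (f2P x).
- by have [c /f_eq[]] := psol_2 sG (f2P x).
- by have [c [d [/f_eq[-> ->] ->]]] := psol_3 sG (f2P x).
- rewrite /third; module_eq F.
Qed.

Definition comb_graph m (f : 'I_m -> V) (M1 M2 : 'M[F]_m) : set (V * V * V) :=
  fun g => exists c, g = (comb f c, comb f (M1 *m c), comb f (M2 *m c)).

Lemma dom_comb_graph m (f : 'I_m -> V) M1 M2 x :
  dom (comb_graph f M1 M2) x <-> in_span f x.
Proof.
split; first by move=> [a [b [c [-> _ _]]]]; apply/in_spanP; exists c.
by move=> /in_spanP[c ->]; exists (comb f (M1 *m c)), (comb f (M2 *m c)), c.
Qed.

(** A matrix decomposition is carried over by a free family; the key point is that [third] then acts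
    as [M3]. *)
Lemma partial_sol_comb m (f : 'I_m -> V) (B M1 M2 M3 : 'M[F]_m) :
  (forall c, comb f c = 0 -> c = 0) ->
  (forall c, w (comb f c) = comb f (B *m c)) ->
  M1 *m M1 = s1 *: M1 - t1%:M -> M2 *m M2 = s2 *: M2 - t2%:M ->
  M3 *m M3 = s3 *: M3 - t3%:M -> B + lam%:M = M1 + M2 + M3 ->
  partial_sol (comb_graph f M1 M2).
Proof.
move=> free_f wf M1E M2E M3E eqM.
have quad (M : 'M[F]_m) s t c : M *m M = s *: M - t%:M ->
    comb f (M *m (M *m c)) = s *: comb f (M *m c) - t *: comb f c.
  by move=> ME; rewrite mulmxA ME mulmxBl -scalemxAl mul_scalar_mx linearB !linearZ.
have thirdE c : third (comb f c) (comb f (M1 *m c)) (comb f (M2 *m c)) = comb f (M3 *m c).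
  rewrite /third wf -linearZ -linearD -!linearB -mul_scalar_mx -!mulmxDl -!mulmxBl.
  by rewrite [lam%:M + _]addrC eqM -addrA -opprD addrC addKr.
split.
- split; first by exists 0; rewrite !mulmx0 !linear0.
  move=> k _ _ [c ->] [d ->]; exists (k *: c + d).
  by rewrite !mulmxDr -!scalemxAr !linearP.
- by move=> a b [c [/esym/free_f-> -> ->]]; rewrite !mulmx0 !linear0.
- move=> x a b [c [-> -> _]]; exists (comb f (M2 *m (M1 *m c))), (M1 *m c).
  by rewrite (quad _ _ _ _ M1E).
- move=> x a b [c [-> _ ->]]; exists (comb f (M1 *m (M2 *m c))), (M2 *m c).
  by rewrite (quad _ _ _ _ M2E).
- move=> x a b [c [-> -> ->]]; rewrite thirdE.
  exists (comb f (M1 *m (M3 *m c))), (comb f (M2 *m (M3 *m c))).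
  by rewrite thirdE (quad _ _ _ _ M3E); split=> //; exists (M3 *m c).
Qed.

Variables N1 N2 N3 : 'M[F]_2.
Hypothesis N1E : N1 *m N1 = s1 *: N1 - t1%:M.
Hypothesis N2E : N2 *m N2 = s2 *: N2 - t2%:M.
Hypothesis N3E : N3 *m N3 = s3 *: N3 - t3%:M.
Hypothesis lamE : lam%:M = N1 + N2 + N3.

Definition pair_family x y (i : 'I_2) : V := if i == 0 then x else y.

Lemma comb_pair x y c : comb (pair_family x y) c = c 0 0 *: x + c 1 0 *: y.
Proof.
rewrite /comb !big_ord_recl big_ord0 addr0; congr (_ + c _ _ *: _).
exact: val_inj.
Qed.

Definition pair_ext G x y := addset G (comb_graph (pair_family x y) N1 N2).

Lemma pair_ext_sub G x y : G `<=` pair_ext G x y.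
Proof.
move=> g Gg; exists g, 0; split; rewrite ?addr0 //.
by exists 0; rewrite !mulmx0 !linear0.
Qed.

Lemma dom_pair_ext G x y v :
  dom (pair_ext G x y) v <-> add_line (add_line (dom G) x) y v.
Proof.
split.
  move=> [a [b /addsetP[x1 [a1 [b1 [x2 [a2 [b2 [Gg [c [-> _ _]] [-> _ _]]]]]]]]]].
  exists (c 1 0), (c 0 0), a1, b1; rewrite comb_pair.
  by rewrite (_ : _ - _ = x1) //; module_eq F.
move=> [k [l [a [b Gv]]]]; pose c : 'cV[F]_2 := \col_i if i == 0 then l else k.
exists (a + comb (pair_family x y) (N1 *m c)), (b + comb (pair_family x y) (N2 *m c)).
apply/addsetP; do 6!eexists; split; [exact: Gv|by exists c|split=> //].
rewrite comb_pair !mxE /=; module_eq F.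
Qed.

(** Since [w] kills [x] and [y], the operator [lam + w] is [lam I_2] on their plane, where [N1],
    [N2], [N3] solve the problem; the plane is independent of [dom G]. *)
Lemma partial_sol_pair_ext G x y : partial_sol G -> w x = 0 -> w y = 0 ->
  ~ dom G x -> ~ add_line (dom G) x y -> partial_sol (pair_ext G x y).
Proof.
move=> sG wx wy notGx notGy; have sD := dom_subspace (psol_sub sG).
have comb_notin c : dom G (comb (pair_family x y) c) -> c = 0.
  rewrite comb_pair => Gc.
  have c1 : c 1 0 = 0.
    apply/eqP/negPn/negP => c1_neq0; apply: notGy.
    exists (- ((c 1 0)^-1 * c 0 0)).
    rewrite (_ : _ - _ = (c 1 0)^-1 *: (c 0 0 *: x + c 1 0 *: y)); first exact: subspaceZ.
    by rewrite scalerDr !scalerA mulVf // scale1r scaleNr opprK addrC.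
  have c0 : c 0 0 = 0.
    apply/eqP/negPn/negP => c0_neq0; apply: notGx.
    rewrite -[x]scale1r -(mulVf c0_neq0) -scalerA; apply: subspaceZ => //.
    by move: Gc; rewrite c1 scale0r addr0.
  apply/matrixP => i j; rewrite ord1 mxE.
  by case: (ord2_cases i) => ->.
apply: partial_sol_add => //.
  apply: (@partial_sol_comb _ _ 0 _ _ N3) => //.
  - by move=> c c0; apply: comb_notin; rewrite c0; apply: subspace0.
  - by move=> c; rewrite comb_pair linearD !linearZ /= wx wy !scaler0 addr0 mul0mx linear0.
  - by rewrite add0r.
move=> v Gv /dom_comb_graph /in_spanP[c v_eq]; move: Gv; rewrite v_eq.
by move=> /comb_notin->; rewrite linear0.
Qed.

(** Adjoin the planes of [z 0, z 1], then [z 2, z 3], and so on, and take the union of the resulting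
    chain. *)
Lemma pair_up G z : partial_sol G -> (forall i, w (z i) = 0) ->
  (forall i, ~ add_seq (dom G) z i (z i)) ->
  (forall v, exists i, add_seq (dom G) z i v) ->
  exists2 G', partial_sol G' & forall v, dom G' v.
Proof.
move=> sG wz free_z span_z.
pose Gn := fix Gn k := if k is k'.+1 then pair_ext (Gn k') (z k'.*2) (z k'.*2.+1) else G.
have domGn k v : dom (Gn k) v <-> add_seq (dom G) z k.*2 v.
  elim: k v => [|k IHk] v //; rewrite [Gn _]/= dom_pair_ext /=.
  by split; apply: add_line_mono => u; apply: add_line_mono => t; apply IHk.
have sGn k : partial_sol (Gn k).
  elim: k => //= k IHk; apply: partial_sol_pair_ext => //.
    by move=> /domGn; apply: free_z.
  by move=> Gz; apply: (free_z k.*2.+1); apply: add_line_mono Gz => v /domGn.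
have Gn_mono i j : (i <= j)%N -> Gn i `<=` Gn j.
  elim: j => [|j IHj]; first by rewrite leqn0 => /eqP->.
  rewrite leq_eqVlt => /orP[/eqP-> //|/IHj le_ij] g /le_ij; exact: pair_ext_sub.
exists (fun g => exists2 H, (exists k, H = Gn k) & H g).
  apply: partial_sol_bigcup; first by exists G, 0%N.
    move=> _ _ [i ->] [j ->]; case: (leqP i j) => [|/ltnW] /Gn_mono; by [left|right].
  by move=> _ [k ->].
move=> v; have [i Gv] := span_z v.
have [a [b Gnv]] : dom (Gn i) v.
  (* [Gn i] covers the first [2 i] terms of [z], hence the first [i]. *)
  by apply/domGn; apply: add_seq_le Gv; rewrite -addnn leq_addr.
by exists a, b, (Gn i) => //; exists i.
Qed.

(** Zorn's lemma is applied to solutions modulo whose domain [z] stays independent. A maximal one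
    leaves at most one dimension of [Ker w] outside [dom G] plus the span of [z], since otherwise a
    further plane could be adjoined. *)
Lemma partial_sol_extend G0 z : partial_sol G0 -> (forall i, w (z i) = 0) ->
  (forall i, ~ add_seq (dom G0) z i (z i)) ->
  (forall v, exists2 d, dom G0 d & w (v - d) = 0) ->
  exists2 G, partial_sol G & forall v, dom G v.
Proof.
move=> sG0 wz free_z kerw.
(* [G = set0] is allowed only because [Zorn_bigcup] also asks for the union of the empty chain. *)
pose P G := G = set0 \/
  [/\ G0 `<=` G, partial_sol G & forall i, ~ add_seq (dom G) z i (z i)].
have P_bigcup (C : set (set (V * V * V))) : C `<=` P -> total_on C subset ->
    P (\bigcup_(G in C) G).
  (* [C'] drops the empty graph, so all its members are genuine solutions. *)
  move=> CP totC; pose C' G := C G /\ G <> set0.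
  have UE : \bigcup_(G in C) G = fun g => exists2 G, C' G & G g.
    apply/seteqP; split=> g /= [G CG Gg]; last by case: CG => CG _; exists G.
    by exists G => //; split=> // G0E; rewrite G0E in Gg.
  have C'P G : C' G -> [/\ G0 `<=` G, partial_sol G & forall i, ~ add_seq (dom G) z i (z i)].
    by move=> [CG nG]; case: (CP _ CG).
  have [[G C'G]|C'0] := EM (exists G, C' G); last first.
    left; apply/seteqP; split=> // g; rewrite UE => -[G C'G _].
    by apply: C'0; exists G.
  right; rewrite UE; split.
  - by move=> g G0g; exists G => //; case: (C'P _ C'G) => + _ _; apply.
  - apply: partial_sol_bigcup; first by exists G.
      by move=> H K [CH _] [CK _]; apply: totC.
    by move=> H /C'P[].
  - move=> i domz.
    (* Membership modulo finitely many [z i] rests on one point of the union, hence on one member of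
       the chain. *)
    have add_seq_union v : add_seq (dom (fun g => exists2 H, C' H & H g)) z i v ->
        exists2 H, C' H & add_seq (dom H) z i v.
      elim: i v {domz} => [|i IHi] v /=.
        by move=> [a [b [H CH Hv]]]; exists H => //; exists a, b.
      by move=> [k /IHi[H CH Hv]]; exists H => //; exists k.
    by have [H /C'P[_ _ +]] := add_seq_union _ domz; move=> /[apply].
have [G [PG maxG]] := Zorn_bigcup P_bigcup.
have G0n : G0 (0, 0, 0) by case: (psol_sub sG0).
have [G00 sG free_zG] : [/\ G0 `<=` G, partial_sol G & forall i, ~ add_seq (dom G) z i (z i)].
  (* The empty graph is not maximal, as [G0] strictly contains it. *)
  case: PG => // GE; case: (maxG G0); last by right; split.
  rewrite GE; split=> [? //|/(_ _ G0n)//].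
have sD := dom_subspace (psol_sub sG).
(* [Q] is [dom G] plus the span of the whole reserved sequence. *)
pose Q v := exists i, add_seq (dom G) z i v.
have sQ : is_subspace Q.
  split; first by exists 0%N; case: sD.
  move=> k x y [i Qx] [j Qy]; exists (maxn i j).
  case: (add_seq_subspace z (maxn i j) sD) => _; apply.
    by apply: add_seq_le Qx; apply: leq_maxl.
  by apply: add_seq_le Qy; apply: leq_maxr.
have DQ v : dom G v -> Q v by exists 0%N.
have zQ i : Q (z i) by exists i.+1; apply: add_line_mem; apply: add_seq_subspace.
have DP i v : add_seq (dom G) z i v -> Q v by exists i.
have kerw_full (R : V -> Prop) : is_subspace R -> (forall v, dom G v -> R v) ->
    (forall v, w v = 0 -> R v) -> forall v, R v.
  move=> sR DR kR v; have [d [a [b G0d]] wvd] := kerw v; rewrite -(subrK d v).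
  by apply: subspaceD => //; [apply: kR|apply: DR; exists a, b; apply: G00].
have [QT|/existsNP[x /not_implyP[wx notQx]]] := EM (forall v, w v = 0 -> Q v).
  by apply: (@pair_up G z) => //; apply: kerw_full.
have sQx := add_line_subspace x sQ.
(* A vector [y] of [Ker w] outside [Q + F x] would let the plane of [x] and [y] be adjoined, against
   maximality. *)
have QxT : forall v, w v = 0 -> add_line Q x v.
  move=> y wy; apply: contrapT => notQy.
  have notGx : ~ dom G x by move=> /DQ.
  have notGy : ~ add_line (dom G) x y by move=> Gy; apply: notQy; apply: add_line_mono Gy.
  apply: (maxG (pair_ext G x y)).
    split; first exact: pair_ext_sub.
    move=> GG'; apply: notGx; have [a [b Gx]] : dom (pair_ext G x y) x.
      by apply/dom_pair_ext; apply: sub_add_line; apply: add_line_mem.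
    by exists a, b; apply: GG'.
  right; split; [exact: subset_trans G00 (@pair_ext_sub _ _ _)|exact: partial_sol_pair_ext|].
  move=> i domz.
  have : add_line (add_line (add_seq (dom G) z i) x) y (z i).
    have : add_seq (add_line (add_line (dom G) x) y) z i (z i).
      by apply: add_seq_mono domz => v /dom_pair_ext.
    move=> /add_seq_line; apply: add_line_mono => v; exact: (proj1 (add_seq_line _ _ _ _ _)).
  have sPi := add_seq_subspace z i sD.
  (* Two exchanges keep [z i] independent: one uses that [y] is outside [Q + F x], the other that
     [x] is outside [Q]. *)
  apply: (add_line_notin (add_line_subspace x sPi) sQx) => //.
  - by move=> v; apply: add_line_mono; apply: DP.
  - exact: sub_add_line.
  - by apply: (add_line_notin sPi sQ) => //; apply: DP.
(* The leftover vector [x] goes in front of the reserved sequence [z]. *)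
pose z' i := if i is i'.+1 then z i' else x.
have z'E i v : add_seq (dom G) z' i.+1 v <-> add_line (add_seq (dom G) z i) x v.
  elim: i v => [|i IHi] v //; rewrite [add_seq _ _ i.+2]/= [add_seq _ z i.+1]/=.
  split=> [zv|/add_lineC zv]; last by apply: add_line_mono zv => u; apply IHi.
  by apply: add_lineC; apply: add_line_mono zv => u; apply IHi.
apply: (@pair_up G z') => //.
- by case.
- case=> [/DQ //|i /z'E]; apply: (add_line_notin (add_seq_subspace z i sD) sQ) => //.
    by move=> v; apply: DP.
  exact: zQ i.
- move=> v; have [k [j Qv]] := kerw_full _ sQx (fun v Dv => sub_add_line x (DQ v Dv)) QxT v.
  by exists j.+1; apply/z'E; exists k.
Qed.

End PartialSolutions.

(** Derives an equation from a known one by comparing differences, a goal that [module_eq] can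
    settle. *)
Lemma eq_of_subr (V : zmodType) (a b c d : V) : a = b -> c - d = a - b -> c = d.
Proof. by move=> -> /eqP; rewrite subrr subr_eq0 => /eqP. Qed.

(** * Completing a family by vectors of [Ker w] *)

Section FiniteExtensions.
Variables (F : fieldType) (V : lmodType F) (w : {linear V -> V}).
Variables (n : nat) (e : 'I_n -> V).
Hypothesis kerw : forall x, exists y, in_span e y /\ w (x - y) = 0.
Implicit Types (z : nat -> V).

(** Infinite dimension gives a vector outside the space built so far; subtracting a vector of the
    span of [e] with the same image under [w] moves it into [Ker w]. *)
Lemma indep_sequence : infinite_dim V ->
  exists2 z : nat -> V, forall i, w (z i) = 0
    & forall i, ~ add_seq (in_span e) z i (z i).
Proof.
move=> infV; have sW := in_span_subspace e.
have next (s : seq V) : exists x, w x = 0 /\ ~ add_seq (in_span e) (nth 0 s) (size s) x.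
  have [x notx] := infV _ (fcat e (trunc (nth 0 s) (size s))).
  have [y [Wy wxy]] := kerw x; exists (x - y); split=> // Wxy.
  apply/notx/in_span_fcat; rewrite -(subrK y x).
  by apply: subspaceD Wxy (add_seq_le (leq0n _) Wy); apply: add_seq_subspace.
have [g gP] := choice next.
(* [S k] lists the first [k] chosen vectors. *)
pose S := fix S k := if k is k'.+1 then rcons (S k') (g (S k')) else [::].
have size_S k : size (S k) = k by elim: k => //= k IHk; rewrite size_rcons IHk.
have nth_S k i : (i < k)%N -> nth 0 (S k) i = g (S i).
  elim: k => // k IHk; rewrite ltnS leq_eqVlt nth_rcons size_S.
  by case: ltngtP => [lt_ik _|//|-> _]; first exact: IHk.
exists (fun i => g (S i)) => i; first by case: (gP (S i)).
case: (gP (S i)) => _; rewrite size_S.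
by rewrite (@eq_add_seq _ _ _ (nth 0 (S i)) (fun i => g (S i))) // => j /nth_S.
Qed.

Lemma indep_extension (s : seq V) : exists z q,
  [/\ forall i, w (z i) = 0, forall i, (i < q)%N -> ~ add_seq (in_span e) z i (z i),
      forall x, x \in s -> add_seq (in_span e) z q x
    & forall P : V -> Prop, is_subspace P -> (forall x, in_span e x -> P x) ->
        (forall x, x \in s -> P x) -> forall x, add_seq (in_span e) z q x -> P x].
Proof.
(* Each [x] in [s] is corrected by some [y] in the span of [e] so that [x - y] is in [Ker w], and
   [x - y] is adjoined only if it is new. *)
have sW := in_span_subspace e.
elim: s => [|x s [z [q [wz free_z sz minz]]]].
  by exists (fun _ => 0), 0%N; split=> // i; apply: linear0.
have [y [Wy wxy]] := kerw x.
have sE := add_seq_subspace z q sW.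
have Ey : add_seq (in_span e) z q y by apply: (add_seq_le (leq0n q) Wy).
have [Exy|notExy] := EM (add_seq (in_span e) z q (x - y)).
  exists z, q; split=> //.
    by move=> v; rewrite inE => /orP[/eqP->|/sz //]; rewrite -(subrK y x); apply: subspaceD.
  by move=> P sP WP sxP; apply: minz => // v sv; apply: sxP; rewrite inE sv orbT.
pose z' i := if i == q then x - y else z i.
have z'E i : (i <= q)%N -> add_seq (in_span e) z' i = add_seq (in_span e) z i.
  move=> le_iq; apply: eq_add_seq => j lt_ji; rewrite /z' ifN //.
  by rewrite neq_ltn (leq_trans lt_ji le_iq).
have z'q : z' q = x - y by rewrite /z' eqxx.
exists z', q.+1; split.
- by move=> i; rewrite /z'; case: eqP.
- move=> i; rewrite ltnS => le_iq; rewrite z'E // /z'; case: eqP => [-> //|/eqP neq_iq].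
  by apply: free_z; rewrite ltn_neqAle neq_iq.
- move=> v; rewrite inE /= z'E // z'q => /orP[/eqP->|/sz Ev]; last exact: sub_add_line.
  rewrite -[v in add_line _ _ v](subrK y x); apply: subspaceD; first exact: add_line_subspace.
    exact: add_line_mem.
  exact: sub_add_line.
- move=> P sP WP sxP v; rewrite /= z'E // z'q; apply: add_line_min => //.
    by apply: minz => // u su; apply: sxP; rewrite inE su orbT.
  by apply: subspaceB; [|apply: sxP; rewrite inE eqxx|apply: WP].
Qed.

End FiniteExtensions.

Ltac subspace_closed :=
  intros; repeat first
    [ solve [auto] | apply: subspaceB | apply: subspaceD | apply: subspaceZ
    | progress auto ].

(** * Relations between the three quadratic operators *)

Section Relations.
Variables (F : fieldType) (V : lmodType F) (w u1 u2 u3 : {linear V -> V}).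
Variables (lam s1 t1 s2 t2 s3 t3 : F).
Hypothesis u1E : forall x, u1 (u1 x) = s1 *: u1 x - t1 *: x.
Hypothesis u2E : forall x, u2 (u2 x) = s2 *: u2 x - t2 *: x.
Hypothesis u3E : forall x, u3 (u3 x) = s3 *: u3 x - t3 *: x.
Hypothesis sumE : forall x, lam *: x + w x = u1 x + u2 x + u3 x.

Let u3_def x : u3 x = lam *: x + w x - u1 x - u2 x.
Proof. by rewrite sumE; module_eq F. Qed.

(* [u3] is quadratic, so modulo [w] the elements [1], [u1], [u2], [u1 u2] span the
   algebra generated by [u1] and [u2]. *)
Lemma anticommutator x : u2 (u1 x) + u1 (u2 x) =
  (2%:R * lam - s3 - s1) *: u1 x + (2%:R * lam - s3 - s2) *: u2 x
  + (s3 * lam - t3 - lam ^+ 2 + t1 + t2) *: x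
  + ((s3 - lam) *: w x - w (u3 x) + u1 (w x) + u2 (w x)).
Proof.
have u_third (u : {linear V -> V}) :
    u (u3 x) = lam *: u x + u (w x) - u (u1 x) - u (u2 x).
  by rewrite u3_def !linearB linearD linearZ.
(* The term [w (u3 x)] is left unexpanded: it already lies in the image of [w]. *)
have := u3E x; rewrite {1}u3_def (u_third u1) (u_third u2) u1E u2E => eq_u3.
apply: (eq_of_subr eq_u3); rewrite u3_def; module_eq F.
Qed.

Variable E : V -> Prop.
Hypothesis sE : is_subspace E.
Hypothesis wE : forall x, E (w x).

Section Generators.
Variables (n : nat) (e : 'I_n -> V).
Hypothesis wW : forall x, in_span e (w x).
Hypothesis eE : forall i, E (e i).
Hypothesis u1eE : forall i, E (u1 (e i)).
Hypothesis u2eE : forall i, E (u2 (e i)).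
Hypothesis u12eE : forall i, E (u1 (u2 (e i))).
Hypothesis minE : forall P : V -> Prop, is_subspace P ->
  (forall i, P (e i)) -> (forall i, P (u1 (e i))) -> (forall i, P (u2 (e i))) ->
  (forall i, P (u1 (u2 (e i)))) -> forall x, E x -> P x.

Let span_lin (u : {linear V -> V}) : (forall i, E (u (e i))) -> forall x, E (u (w x)).
Proof.
move=> ue x; have [c ->] := wW x; rewrite linear_sum; apply: subspace_sum => // i.
by rewrite linearZ; apply: subspaceZ.
Qed.

Lemma stable_u1 x : E x -> E (u1 x).
Proof.
have E1 v : E (u1 v) -> E v -> E (u1 (u1 v)).
  by move=> E1v Ev; rewrite u1E; apply: subspaceB => //; apply: subspaceZ.
move: x; apply: minE => //; first exact: subspace_preim.
- by move=> i; apply: E1.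
- by move=> i; apply: E1.
Qed.

(** The anticommutator relation turns [u2 u1] into [-(u1 u2)] plus terms already in [E]; the error
    terms [u1 (w x)] and [u2 (w x)] are in [E] because [w x] is in the span of [e]. *)
Lemma stable_u2 x : E x -> E (u2 x).
Proof.
have E21 v : E (u1 v) -> E (u2 v) -> E v -> E (u1 (u2 v)) -> E (u2 (u1 v)).
  move=> E1v E2v Ev E12v.
  rewrite -[u2 (u1 v)](addrK (u1 (u2 v))) anticommutator.
  have := span_lin u1eE; have := span_lin u2eE; subspace_closed.
have E22 v : E (u2 v) -> E v -> E (u2 (u2 v)).
  by move=> E2v Ev; rewrite u2E; apply: subspaceB => //; apply: subspaceZ.
move: x; apply: minE => //; first exact: subspace_preim.
- by move=> i; apply: E21.
- by move=> i; apply: E22.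
- by move=> i; apply: E21 => //; [apply: E22|apply: stable_u1; apply: E22].
Qed.

End Generators.

Hypothesis E1 : forall x, E x -> E (u1 x).
Hypothesis E2 : forall x, E x -> E (u2 x).

Lemma stable_u3 x : E x -> E (u3 x).
Proof.
by move=> Ex; rewrite u3_def; subspace_closed.
Qed.

(** Take the commutator of [u1] with the anticommutator relation. The left side becomes
    [u1^2 u2 - u2 u1^2 = s1 (u1 u2 - u2 u1)], the right side [(2 lam - s3 - s2) (u1 u2 - u2 u1)]
    plus a term in [E]. *)
Lemma commutator_mod x : E ((s1 + s2 + s3 - 2%:R * lam) *: (u1 (u2 x) - u2 (u1 x))).
Proof.
have [r rE anti] : exists2 r : V -> V, forall v, E (r v) & forall v,
    u2 (u1 v) + u1 (u2 v) =
    (2%:R * lam - s3 - s1) *: u1 v + (2%:R * lam - s3 - s2) *: u2 v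
    + (s3 * lam - t3 - lam ^+ 2 + t1 + t2) *: v + r v.
  by eexists => v; last exact: anticommutator; subspace_closed.
have u2u1u1 : u2 (u1 (u1 x)) = s1 *: u2 (u1 x) - t1 *: u2 x.
  by rewrite u1E linearB !linearZ_LR.
suff -> : (s1 + s2 + s3 - 2%:R * lam) *: (u1 (u2 x) - u2 (u1 x)) = u1 (r x) - r (u1 x).
  by subspace_closed.
have rx := congr1 u1 (anti x); rewrite !linearD !linearZ /= !u1E in rx.
have rux := anti (u1 x); rewrite u2u1u1 !u1E in rux.
apply: (eq_of_subr (congr2 (fun a b : V => a - b) rx rux)); rewrite /=; module_eq F.
Qed.

End Relations.

(** * Common eigenvectors modulo a stable subspace *)

Lemma linear_subZ (F : fieldType) (V : lmodType F) (u : {linear V -> V}) a x y :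
  u (x - a *: y) = u x - a *: u y.
Proof. by rewrite linearB linearZ. Qed.

(** As [(u - b) (u - a) = 0], either [x] is an eigenvector for [a] modulo [E], or [(u - a) x] is one
    for [b]. The form of [y] is recorded so that operators commuting with [u] modulo [E] keep their
    eigenvectors. *)
Lemma eigen_mod (F : fieldType) (V : lmodType F) (u : {linear V -> V}) (a b : F)
    (E : V -> Prop) (x : V) :
  (forall x, u (u x) = (a + b) *: u x - (a * b) *: x) -> is_subspace E -> ~ E x ->
  exists y r, [/\ (r == a) || (r == b), ~ E y, E (u y - r *: y)
    & y = x \/ y = u x - a *: x].
Proof.
move=> uE sE notEx; have [Ey|notEy] := EM (E (u x - a *: x)).
  by exists x, a; split; rewrite ?eqxx //; left.
exists (u x - a *: x), b; split; rewrite ?eqxx ?orbT //; last by right.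
rewrite (_ : _ - _ = 0); first exact: subspace0.
rewrite (linear_subZ u) uE; module_eq F.
Qed.

Lemma scalar_or_trace (F : fieldType) (V : lmodType F) (w u1 u2 u3 : {linear V -> V})
    (lam a1 b1 a2 b2 a3 b3 : F) (E : V -> Prop) :
  (forall x, u1 (u1 x) = (a1 + b1) *: u1 x - (a1 * b1) *: x) ->
  (forall x, u2 (u2 x) = (a2 + b2) *: u2 x - (a2 * b2) *: x) ->
  (forall x, u3 (u3 x) = (a3 + b3) *: u3 x - (a3 * b3) *: x) ->
  (forall x, lam *: x + w x = u1 x + u2 x + u3 x) ->
  is_subspace E -> (forall x, E (w x)) ->
  (forall x, E x -> E (u1 x)) -> (forall x, E x -> E (u2 x)) ->
  (exists x, ~ E x) ->
  (exists r1 r2 r3, [/\ (r1 == a1) || (r1 == b1), (r2 == a2) || (r2 == b2),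
     (r3 == a3) || (r3 == b3) & lam = r1 + r2 + r3]) \/
  2%:R * lam = (a1 + b1) + (a2 + b2) + (a3 + b3).
Proof.
move=> u1E u2E u3E sumE sE wE E1 E2 [x notEx].
have [tr0|tr_neq0] := eqVneq ((a1 + b1) + (a2 + b2) + (a3 + b3) - 2%:R * lam) 0.
  by right; apply/esym/eqP; rewrite -subr_eq0 tr0.
have comm y : E (u1 (u2 y) - u2 (u1 y)).
  rewrite -[X in E X]scale1r -(mulVf tr_neq0) -scalerA; apply: subspaceZ => //.
  exact: (commutator_mod u1E u2E u3E sumE sE wE E1 E2).
left.
have [y [r1 [r1P notEy Ey _]]] := eigen_mod u1E sE notEx.
have [v [r2 [r2P notEv Ev2 v_eq]]] := eigen_mod u2E sE notEy.
(* If [v = u2 y - a2 *: y], commutation modulo [E] carries the [r1]-eigenvector property from [y] to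
   [v]. *)
have Ev1 : E (u1 v - r1 *: v).
  case: v_eq => -> //; rewrite (linear_subZ u1).
  have -> : u1 (u2 y) - a2 *: u1 y - r1 *: (u2 y - a2 *: y) =
      (u1 (u2 y) - u2 (u1 y)) + u2 (u1 y - r1 *: y) - a2 *: (u1 y - r1 *: y).
    by rewrite (linear_subZ u2); module_eq F.
  by subspace_closed.
pose r3 := lam - r1 - r2; exists r1, r2, r3; split=> //; last by rewrite /r3; ring.
have Ed : E (u3 v - r3 *: v).
  have -> : u3 v - r3 *: v = w v - (u1 v - r1 *: v) - (u2 v - r2 *: v).
    by apply/esym/(eq_of_subr (sumE v)); rewrite /r3; module_eq F.
  by subspace_closed.
have E3 := stable_u3 sumE sE wE E1 E2.
(* Modulo [E], [v] is an eigenvector of [u3] for [r3], so the quadratic relation of [u3] evaluates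
   at [r3]. *)
have Er : E (((r3 - a3) * (r3 - b3)) *: v).
  have -> : ((r3 - a3) * (r3 - b3)) *: v =
      (a3 + b3 - r3) *: (u3 v - r3 *: v) - u3 (u3 v - r3 *: v).
    by rewrite (linear_subZ u3) u3E; module_eq F.
  by subspace_closed.
rewrite -[r3 == a3]subr_eq0 -[r3 == b3]subr_eq0 -mulf_eq0.
apply/negPn/negP => r_neq0; apply: notEv.
by rewrite -[v]scale1r -(mulVf r_neq0) -scalerA; apply: subspaceZ.
Qed.

(** * Passage between stable subspaces and matrices *)

Section Matrices.
Variables (F : fieldType) (V : lmodType F).

Lemma mulmx_cV_inj m k (M N : 'M[F]_(m, k)) :
  (forall c : 'cV[F]_k, M *m c = N *m c) -> M = N.
Proof.
move=> MN; apply/matrixP => i j.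
by have := congr1 (fun A : 'cV[F]_m => A i 0) (MN (delta_mx j 0)); rewrite -!colE !mxE.
Qed.

Lemma stable_matrix m (f : 'I_m -> V) (u : {linear V -> V}) :
  (forall j, in_span f (u (f j))) ->
  exists M : 'M[F]_m, forall c, u (comb f c) = comb f (M *m c).
Proof.
move=> /choice[c cE]; exists (\matrix_(i, j) c j i) => d; apply: comb_mulmx => j.
by rewrite cE; apply: eq_bigr => i _; rewrite mxE.
Qed.

Lemma matrix_quad m (f : 'I_m -> V) (u : {linear V -> V}) (M : 'M[F]_m) s t :
  (forall c, comb f c = 0 -> c = 0) -> (forall c, u (comb f c) = comb f (M *m c)) ->
  (forall x, u (u x) = s *: u x - t *: x) -> M *m M = s *: M - t%:M.
Proof.
move=> free_f uM uE; apply: mulmx_cV_inj => c; apply/eqP; rewrite -subr_eq0; apply/eqP.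
apply: free_f; rewrite linearB /= -mulmxA -!uM uE mulmxBl -scalemxAl mul_scalar_mx.
by rewrite (linearB (comb f)) !(linearZ_LR (comb f)) /= -uM subrr.
Qed.

Lemma comb_block (w : {linear V -> V}) n (e : 'I_n -> V) (A : 'M[F]_n) z q c :
  matrix_in_basis w e A -> (forall i, w (z i) = 0) ->
  w (comb (fcat e (trunc z q)) c) =
  comb (fcat e (trunc z q)) (block_mx A 0 0 0 *m c).
Proof.
move=> wA wz; rewrite -(vsubmxK c) mul_block_col !mul0mx !addr0 !comb_fcat linear0 addr0.
rewrite linearD /= (comb_mulmx _ wA) [w (comb (trunc _ _) _)]linear_sum big1 ?addr0 // => i _.
by rewrite linearZ /= wz scaler0.
Qed.

Lemma mx_poly_evalE (p : {poly F}) a b m (M : 'M[F]_m) :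
  (forall (U : lmodType F) (y : nat -> U), \sum_(i < size p) p`_i *: y i = 0 <->
     y 2%N = (a + b) *: y 1%N - (a * b) *: y 0%N) ->
  mx_poly_eval p M = 0 <-> M *m M = (a + b) *: M - (a * b)%:M.
Proof.
by move=> pE; rewrite -scalemx1; apply: (pE 'M[F]_m (fun i => M ^+ i)).
Qed.

End Matrices.

(** * The two implications, from operators to block matrices and back *)

Theorem theorem10 (F : fieldType) (V : lmodType F) (w : {linear V -> V})
  (lam : F) (p1 p2 p3 : {poly F}) (n : nat) (A : 'M[F]_n) :
  infinite_dim V -> finite_rank w ->
  split_deg2 p1 -> split_deg2 p2 -> split_deg2 p3 ->
  in_class w A ->
  (end_sum3 p1 p2 p3 (fun x => lam *: x + w x) <->
   ((scalar_sum3 p1 p2 p3 lam \/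
     2%:R * lam = poly_trace p1 + poly_trace p2 + poly_trace p3) /\
    exists q : nat,
      mx_sum3 p1 p2 p3 (block_mx (A + lam%:M) (0 : 'M[F]_(n, q))
                                 (0 : 'M[F]_(q, n)) (lam%:M : 'M[F]_q)))).
Proof.
move=> infV _ /split_deg2P[a1 [b1 [tr1 root1 p1E]]] /split_deg2P[a2 [b2 [tr2 root2 p2E]]].
move=> /split_deg2P[a3 [b3 [tr3 root3 p3E]]] [e [[free_e [[sW [wW kerw]] _]] wA]].
have free_comb c : comb e c = 0 -> c = 0.
  by move=> /free_e c0; apply/matrixP => i j; rewrite ord1 c0 mxE.
have blockE q : block_mx (A + lam%:M) (0 : 'M[F]_(n, q)) (0 : 'M[F]_(q, n)) lam%:M =
    block_mx A 0 0 0 + lam%:M.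
  by rewrite [(lam%:M : 'M_(n + q))]scalar_mx_block add_block_mx !addr0 add0r.
rewrite tr1 tr2 tr3; split.
- move=> [u1 [u2 [u3 [u1p u2p u3p sumE]]]].
  have u1E x : u1 (u1 x) = (a1 + b1) *: u1 x - (a1 * b1) *: x.
    by have /p1E := u1p x.
  have u2E x : u2 (u2 x) = (a2 + b2) *: u2 x - (a2 * b2) *: x.
    by have /p2E := u2p x.
  have u3E x : u3 (u3 x) = (a3 + b3) *: u3 x - (a3 * b3) *: x.
    by have /p3E := u3p x.
  (* Together with [e], these vectors span [W + u1 W + u2 W + u1 u2 W]. *)
  pose s := [seq u1 (e i) | i <- enum 'I_n] ++ [seq u2 (e i) | i <- enum 'I_n] ++
    [seq u1 (u2 (e i)) | i <- enum 'I_n].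
  have [z [q [wz free_z sE minE]]] := indep_extension kerw s.
  set E := add_seq (in_span e) z q in sE minE.
  have subE : is_subspace E by apply: add_seq_subspace.
  have WE x : in_span e x -> E x by move=> Wx; apply: (add_seq_le (leq0n q) Wx).
  have wE x : E (w x) by apply: WE.
  have eE i : E (e i) by apply/WE/in_span_mem.
  have u1eE i : E (u1 (e i)).
    by apply: sE; rewrite !mem_cat; apply/orP; left; apply/mapP; exists i; rewrite ?mem_enum.
  have u2eE i : E (u2 (e i)).
    by apply: sE; rewrite !mem_cat; apply/or3P/Or32/mapP; exists i; rewrite ?mem_enum.
  have u12eE i : E (u1 (u2 (e i))).
    by apply: sE; rewrite !mem_cat; apply/or3P/Or33/mapP; exists i; rewrite ?mem_enum.
  have minE' (P : V -> Prop) : is_subspace P ->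
      (forall i, P (e i)) -> (forall i, P (u1 (e i))) -> (forall i, P (u2 (e i))) ->
      (forall i, P (u1 (u2 (e i)))) -> forall x, E x -> P x.
    move=> sP Pe Pu1 Pu2 Pu12; apply: minE => //.
      by move=> x [c ->]; apply: subspace_sum => // i; apply: subspaceZ.
    by move=> x; rewrite !mem_cat => /or3P[] /mapP[i _ ->].
  have E1 : forall x, E x -> E (u1 x) by exact: (stable_u1 u1E subE eE u1eE u2eE u12eE minE').
  have E2 : forall x, E x -> E (u2 x).
    exact: (stable_u2 u1E u2E u3E sumE subE wE wW eE u1eE u2eE u12eE minE').
  have E3 : forall x, E x -> E (u3 x) by exact: (stable_u3 sumE subE wE E1 E2).
  split.
    have [|[r1 [r2 [r3 [r1P r2P r3P ->]]]]|trE] :=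
      scalar_or_trace u1E u2E u3E sumE subE wE E1 E2; last by right.
      have [x notx] := infV _ (fcat e (trunc z q)); exists x => Ex.
      by apply: notx; apply/in_span_fcat.
    by left; exists r1, r2, r3; rewrite root1 root2 root3.
  (* [q] counts the vectors of [Ker w] that complete [e] to a basis of [E]; there [w] has matrix [A]
     bordered by zeros. *)
  exists q; set f := fcat e (trunc z q).
  have free_f : forall c, comb f c = 0 -> c = 0 by apply: fcat_free.
  have stable (u : {linear V -> V}) : (forall x, E x -> E (u x)) ->
      exists M : 'M[F]_(n + q), forall c, u (comb f c) = comb f (M *m c).
    move=> Eu; apply: stable_matrix => j; apply/in_span_fcat/Eu/in_span_fcat.
    exact: in_span_mem.
  have [M1 u1M] := stable _ E1; have [M2 u2M] := stable _ E2.
  have [M3 u3M] := stable _ E3.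
  exists M1, M2, M3; split.
  + exact/(mx_poly_evalE _ p1E)/(matrix_quad free_f u1M).
  + exact/(mx_poly_evalE _ p2E)/(matrix_quad free_f u2M).
  + exact/(mx_poly_evalE _ p3E)/(matrix_quad free_f u3M).
  + rewrite blockE; apply: mulmx_cV_inj => c; apply/eqP; rewrite -subr_eq0; apply/eqP.
    apply: free_f; rewrite linearB /= !mulmxDl mul_scalar_mx !linearD linearZ_LR /=.
    by rewrite -(comb_block c wA wz) -u1M -u2M -u3M -!opprD -sumE [w _ + _]addrC subrr.
- move=> [lamP [q [M1 [M2 [M3 [/(mx_poly_evalE _ p1E) M1E /(mx_poly_evalE _ p2E) M2E
    /(mx_poly_evalE _ p3E) M3E]]]]]]; rewrite blockE => sumM.
  have [N1 [N2 [N3 [N1E N2E N3E sumN]]]] : exists N1 N2 N3 : 'M[F]_2,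
      [/\ N1 *m N1 = (a1 + b1) *: N1 - (a1 * b1)%:M,
          N2 *m N2 = (a2 + b2) *: N2 - (a2 * b2)%:M,
          N3 *m N3 = (a3 + b3) *: N3 - (a3 * b3)%:M
        & lam%:M = N1 + N2 + N3].
    (* If [lam] is a sum of roots, scalar matrices suffice; the trace condition uses
       [scalar_block_sum]. *)
    case: lamP => [[r1 [r2 [r3 []]]]|]; last exact: scalar_block_sum.
    rewrite root1 root2 root3 => r1P r2P r3P ->.
    have quad (a b r : F) : (r == a) || (r == b) ->
        r%:M *m r%:M = (a + b) *: r%:M - (a * b)%:M :> 'M[F]_2.
      move=> rP; rewrite -scalar_mxM scale_scalar_mx -raddfB; congr _%:M.
      by case/orP: rP => /eqP->; ring.
    by exists r1%:M, r2%:M, r3%:M; rewrite !raddfD; split=> //; apply: quad.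
  have [z wz free_z] := indep_sequence kerw infV.
  (* The first [q] terms of [z] carry the block [lam I_q]; the later ones form the reserved
     sequence. *)
  pose f := fcat e (trunc z q).
  have free_f : forall c, comb f c = 0 -> c = 0 by apply: fcat_free.
  have sG0 := partial_sol_comb free_f (fun c : 'cV_(n + q) => comb_block c wA wz) M1E M2E M3E sumM.
  have domG0 v : dom (comb_graph f M1 M2) v <-> add_seq (in_span e) z q v.
    by rewrite dom_comb_graph in_span_fcat.
  have [||v|G sG domG] := partial_sol_extend N1E N2E N3E sumN
    (z := fun i => z (q + i)%N) sG0.
  + by [].
  + move=> i zi; apply: (free_z (q + i)%N); rewrite -add_seq_add.
    by apply: add_seq_mono zi => v /domG0.
  + have [y [Wy wvy]] := kerw v; exists y => //; apply/domG0.
    exact: (add_seq_le (leq0n q) Wy).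
  have [u1 [u2 [u3 [u1E u2E u3E sumE]]]] := partial_sol_total sG domG.
  exists u1, u2, u3; split=> // x.
  + by apply/p1E; apply: u1E.
  + by apply/p2E; apply: u2E.
  + by apply/p3E; apply: u3E.
Qed.
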